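(* Let $V$ be a vector space over a division ring $D$, with a basis consisting of elements $b_{n,i}$ for all positive integers $n$ and $i$ with $i\le n$, and one more basis element $b_+$. Let $x\in\mathrm{End}_D(V)$ be the endomorphism given by $$x(b_{n,i})=b_{n,i+1}\ \text{ if } i<n,\qquad x(b_{n,n})=b_+\ \text{ for all } n,\qquad x(b_+)=0.$$ Then $x$ has no strong inner inverse in $\mathrm{End}_D(V)$. In fact, $x$ has no strong inner inverse in the monoid of all set-maps $V\to V$.
   Context: For elements $x,y$ of a monoid $M$, $y$ is called a strong inner inverse to $x$ (in $M$) if $x^i y^j x^k = y^{j-i}x^j y^{j-k}$ for all integers $i,j,k$ with $0\le i\le j$ and $0\le k\le j$. For the ring $\mathrm{End}_D(V)$ the multiplicative monoid is meant; maps are written on the left of their arguments and composed accordingly. *)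

(* Defs.v *)
(* Mathematical Components, with the classical axioms of
   mathcomp.classical.boolp. *)
From HB Require Import structures.
From mathcomp Require Import all_boot all_order all_algebra.
From mathcomp Require Import boolp.

Set Implicit Arguments.
Unset Strict Implicit.
Unset Printing Implicit Defensive.

Section StrongInnerInverse.
Local Open Scope group_scope.

(* The exponents j - i and j - k are nonnegative under the hypotheses, so the
   truncated subtraction of nat is the usual one. *)
Definition strong_inner_inverse (M : monoidType) (x y : M) : Prop :=
  forall i j k : nat, (i <= j)%N -> (k <= j)%N ->
    x ^+ i * y ^+ j * x ^+ k = y ^+ (j - i) * x ^+ j * y ^+ (j - k).

End StrongInnerInverse.

(* An alias of V -> V whose product is composition, to keep it apart from the
   pointwise structures that MathComp-Analysis puts on function types. *)
Definition selfmap (V : Type) : Type := V -> V.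

Section SelfmapMonoid.
Variable V : Type.

Definition selfmap_mul (f g : selfmap V) : selfmap V := f \o g.
Definition selfmap_one : selfmap V := idfun.

Lemma selfmap_mulA : associative selfmap_mul.
Proof. by []. Qed.

Lemma selfmap_mul1 : left_id selfmap_one selfmap_mul.
Proof. by []. Qed.

Lemma selfmap_mulr1 : right_id selfmap_one selfmap_mul.
Proof. by []. Qed.

(* monoidType requires an equality test and a choice operator on the carrier;
   boolp supplies them classically. *)
HB.instance Definition _ := gen_eqMixin (selfmap V).
HB.instance Definition _ := gen_choiceMixin (selfmap V).
HB.instance Definition _ :=
  isMonoid.Build (selfmap V) selfmap_mulA selfmap_mul1 selfmap_mulr1.

End SelfmapMonoid.

Local Open Scope ring_scope.

(* An alias of {linear V -> V} carrying the multiplicative monoid of the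
   endomorphism ring of V. *)
Definition endomorphism (D : nzRingType) (V : lmodType D) : Type :=
  {linear V -> V}.

Section EndomorphismMonoid.
Variables (D : nzRingType) (V : lmodType D).

Definition endomorphism_mul (f g : endomorphism V) : endomorphism V := f \o g.
Definition endomorphism_one : endomorphism V := @idfun V.

Lemma endomorphism_ext (f g : endomorphism V) : f =1 g -> f = g.
Proof.
case: f g => [f [[pf0] [pf1]]] [g [[pg0] [pg1]]] /= /funext efg.
by subst g; do 3?f_equal; exact: Prop_irrelevance.
Qed.

Lemma endomorphism_mulA : associative endomorphism_mul.
Proof. by move=> f g h; exact: endomorphism_ext. Qed.

Lemma endomorphism_mul1 : left_id endomorphism_one endomorphism_mul.
Proof. by move=> f; exact: endomorphism_ext. Qed.

Lemma endomorphism_mulr1 : right_id endomorphism_one endomorphism_mul.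
Proof. by move=> f; exact: endomorphism_ext. Qed.

HB.instance Definition _ := gen_eqMixin (endomorphism V).
HB.instance Definition _ := gen_choiceMixin (endomorphism V).
HB.instance Definition _ :=
  isMonoid.Build (endomorphism V)
    endomorphism_mulA endomorphism_mul1 endomorphism_mulr1.

End EndomorphismMonoid.

Section Basis.
Variables (D : nzRingType) (V : lmodType D) (I : eqType) (b : I -> V).

Definition linearly_independent : Prop :=
  forall (s : seq I) (a : I -> D), uniq s ->
    \sum_(i <- s) a i *: b i = 0 -> forall i, i \in s -> a i = 0.

Definition spanning : Prop :=
  forall v : V, exists (s : seq I) (a : I -> D), v = \sum_(i <- s) a i *: b i.

Definition is_basis : Prop := linearly_independent /\ spanning.

End Basis.

(* The axiom of fields without commutativity; D is nontrivial as a
   unitRingType. *)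
Definition is_division_ring (D : unitRingType) : Prop := GRing.field_axiom D.

(* The indices (n, i) with 1 <= i <= n, together with None for b_+. *)
Definition basis_index : Type := option {p : nat * nat | (0 < p.2 <= p.1)%N}.
HB.instance Definition _ := Countable.on basis_index.

(* Only the values b n i with 1 <= i <= n are used. *)
Definition basis_family (V : Type) (b : nat -> nat -> V) (bplus : V)
    (u : basis_index) : V :=
  if u is Some p then b (val p).1 (val p).2 else bplus.

(* Main.v *)
From HB Require Import structures.
Require Import Defs.
From mathcomp Require Import all_boot all_order all_algebra.
From mathcomp Require Import boolp.

(** If [y] is a strong inner inverse to [x] and [u = x ^+ n.+1 z], then the
    identity [x ^+ n * y ^+ n.+1 * x ^+ n.+1 = y * x ^+ n.+1], evaluated at [z],
    puts [y u] in the image of [x ^+ n].  Here [bplus = x ^+ n (b n 1)] for every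
    positive [n], so [y bplus] lies in the image of every power of [x]; moreover
    [x (y bplus) = bplus] because [x * y * x = x].  These
    identities only evaluate maps at points, so both halves of the theorem come
    from the monoid of self-maps.

    No vector has these two properties.  On coordinates [x] acts by a shift: the
    coordinate at [(n, i.+1)] of [x v] is the coordinate at [(n, i)] of [v], and
    the coordinate at [(n, 1)] of [x v] is [0].  Thus a vector in the image of
    every power of [x] has zero coordinate at every [(n, i)]
    ([coordinate_iter_eq0]), so it is a multiple of [bplus] and is killed
    by [x] ([infinite_height_not_preimage]).  The coordinates come from
    [basis_coordinates]. *)

Set Implicit Arguments.
Unset Strict Implicit.
Unset Printing Implicit Defensive.

Import GRing.Theory.
Local Open Scope ring_scope.

(** * Coordinates with respect to a basis *)

Section Coordinates.
Variables (D : nzRingType) (V : lmodType D) (I : eqType) (b : I -> V).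

(** Requiring [a] to vanish off the list [s] makes the whole function [a], not
    only its values on [s], depend on [v] alone when [b] is independent. *)
Definition expansion (v : V) (a : I -> D) (s : seq I) : Prop :=
  [/\ uniq s, forall i, i \notin s -> a i = 0 & v = \sum_(i <- s) a i *: b i].

Lemma expansion_widen v a s t :
  expansion v a s -> uniq t -> {subset s <= t} -> expansion v a t.
Proof.
move=> [us as0 ->] ut st; split=> // [i it|].
  by apply: as0; apply: contra it; apply: st.
rewrite [RHS](bigID (mem s)) /= [X in _ + X]big1 ?addr0; last first.
  by move=> i /as0 ->; rewrite scale0r.
rewrite -[RHS]big_filter; apply: perm_big; apply: uniq_perm => //.
  exact: filter_uniq.
by move=> i; rewrite mem_filter; case: (boolP (i \in s)) => //= /st ->.
Qed.

Lemma expansion_linear k u v a c s t :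
  expansion u a s -> expansion v c t ->
  expansion (k *: u + v) (fun i => k * a i + c i) (undup (s ++ t)).
Proof.
move=> hu hv; have uU := undup_uniq (s ++ t).
have [|_ a0 ->] := expansion_widen hu uU.
  by move=> i; rewrite mem_undup mem_cat => ->.
have [|_ c0 ->] := expansion_widen hv uU.
  by move=> i; rewrite mem_undup mem_cat orbC => ->.
split=> // [i hi|]; first by rewrite a0 // c0 // mulr0 addr0.
rewrite scaler_sumr -big_split /=; apply: eq_bigr => i _.
by rewrite scalerA scalerDl.
Qed.

Lemma expansion_basis j : expansion (b j) (fun i => (i == j)%:R) [:: j].
Proof.
split=> // [i|]; first by rewrite inE => /negPf ->.
by rewrite big_seq1 eqxx scale1r.
Qed.

Lemma expansion_exists : spanning b -> forall v, exists a s, expansion v a s.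
Proof.
move=> sb v; have [s [a ->]] := sb v.
elim: s => [|i s [c [t ih]]].
  by exists (fun=> 0), [::]; split=> //; rewrite !big_nil.
by rewrite big_cons; do 2!eexists; apply: expansion_linear ih; apply: expansion_basis.
Qed.

Lemma expansion_unique v a c s t : linearly_independent b ->
  expansion v a s -> expansion v c t -> a =1 c.
Proof.
move=> lb ha hc i.
have [us e0] := expansion_linear (-1) ha hc.
rewrite scaleN1r addNr => /esym/(lb _ _ us) e1.
have : -1 * a i + c i = 0.
  by case: (boolP (i \in undup (s ++ t))) => [/e1|/e0].
by rewrite mulN1r addrC => /subr0_eq.
Qed.

Lemma basis_coordinates : is_basis b ->
  exists kappa : I -> {linear V -> D^o},
    (forall i j, kappa i (b j) = (i == j)%:R) /\
    (forall v, exists s, v = \sum_(i <- s) kappa i v *: b i).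
Proof.
move=> [lb sb].
have [f hf] := choice (expansion_exists sb).
have flin i : linear (fun v => f v i : D^o).
  move=> k u v; have [s hu] := hf u; have [t hv] := hf v.
  have [r huv] := hf (k *: u + v).
  exact: expansion_unique lb huv (expansion_linear k hu hv) i.
pose kappa i : {linear V -> D^o} :=
  HB.pack (fun v => f v i : D^o) (GRing.isLinear.Build _ _ _ _ _ (flin i)).
exists kappa; split=> [i j|v].
  have [s hs] := hf (b j).
  exact: expansion_unique lb hs (expansion_basis j) i.
by have [s [_ _ e]] := hf v; exists s.
Qed.

Lemma linear_eq_on_spanning (W : lmodType D) (f g : {linear V -> W}) :
  spanning b -> (forall i, f (b i) = g (b i)) -> f =1 g.
Proof.
move=> sb fg v; have [s [a ->]] := sb v.
by rewrite !linear_sum; apply: eq_bigr => i _; rewrite !linearZ /= fg.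
Qed.

End Coordinates.

(** * Vectors in the image of every power of the shift *)

Section Shift.
Variables (D : nzRingType) (V : lmodType D) (b : nat -> nat -> V) (bplus : V).
Hypothesis hb : is_basis (basis_family b bplus).
Variable x : {linear V -> V}.
Hypothesis hx : forall n i : nat, (0 < i < n)%N -> x (b n i) = b n i.+1.
Hypothesis hxn : forall n : nat, (0 < n)%N -> x (b n n) = bplus.
Hypothesis hxplus : x bplus = 0.

Lemma iter_shift n i : (i < n)%N -> iter i x (b n 1) = b n i.+1.
Proof.
by elim: i => // i ih lin; rewrite iterS ih ?hx // ltnW.
Qed.

Lemma iter_shift_top n : iter n.+1 x (b n.+1 1) = bplus.
Proof. by rewrite iterS iter_shift // hxn. Qed.

(** The shift moves a basis vector to one with larger second index or to
    [bplus], never to [b n 1]; hence the case [i = 1].  The case [i.+1]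
    reduces to [i] because the coordinate at [(n, i.+1)] composed with [x] is the
    coordinate at [(n, i)]. *)
Lemma coordinate_iter_eq0 (kappa : basis_index -> {linear V -> D^o}) :
  (forall i j, kappa i (basis_family b bplus j) = (i == j)%:R) ->
  forall n i (h : (0 < i <= n)%N) v,
    kappa (Some (exist _ (n, i) h)) (iter i x v) = 0.
Proof.
move=> kb n; elim=> // i ih h v; rewrite iterS.
have [_ sb] := hb.
case: i => [|i] in ih h v *.
  apply: (linear_eq_on_spanning (f := kappa (Some (exist _ (n, 1%N) h)) \o x)
            (g := \0) sb) => -[[[m j] hmj]|] /=; last by rewrite hxplus linear0.
  have /= /andP[j0] := hmj; rewrite leq_eqVlt => /orP[/eqP ejm|jm].
    by rewrite ejm hxn -?ejm // (kb _ None).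
  have hS : (0 < (m, j.+1).2 <= (m, j.+1).1)%N by [].
  rewrite hx ?j0 // (kb _ (Some (exist _ (m, j.+1) hS))).
  by case: eqP => // -[_ ej]; rewrite -ej in j0.
have h' : (0 < (n, i.+1).2 <= (n, i.+1).1)%N by rewrite /= ltnW.
rewrite -(ih h' v).
apply: (linear_eq_on_spanning (f := kappa (Some (exist _ (n, i.+2) h)) \o x)
   (g := kappa (Some (exist _ (n, i.+1) h'))) sb) => -[[[m j] hmj]|]; last first.
  by rewrite /= hxplus linear0 (kb _ None).
rewrite [RHS]kb /=; have /= /andP[j0] := hmj.
have -> : (Some (exist _ (n, i.+1) h') == Some (exist _ (m, j) hmj)
    :> basis_index) = ((n, i.+1) == (m, j)) by [].
rewrite leq_eqVlt => /orP[/eqP ejm|jm].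
  (* Here [x (b m m) = bplus], and [(n, i.+1)] is not on the diagonal since
     [i.+2 <= n]. *)
  rewrite ejm hxn -?ejm // (kb _ None) [LHS]/=.
  case: eqP => // -[enm eij]; move: h.
  by rewrite /= enm eij ltnn.
have hS : (0 < (m, j.+1).2 <= (m, j.+1).1)%N by [].
by rewrite hx ?j0 // (kb _ (Some (exist _ (m, j.+1) hS))).
Qed.

Lemma infinite_height_not_preimage w :
  (forall n, exists v, w = iter n x v) -> x w <> bplus.
Proof.
move=> hw; have [kappa [kb ksum]] := basis_coordinates hb.
have [s ws] := ksum w.
suff -> : x w = 0.
  move=> e0; have := kb None None.
  by rewrite /= -e0 linear0 => /esym/eqP; rewrite oner_eq0.
rewrite ws linear_sum big1 // => -[[[n i] h]|] _; rewrite linearZ /=.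
  have [v ->] := hw i.
  by rewrite coordinate_iter_eq0 // scale0r.
by rewrite hxplus scaler0.
Qed.

End Shift.

(** * Powers of self-maps and of endomorphisms *)

Lemma selfmap_expE (V : Type) (f : selfmap V) n (v : V) :
  (f ^+ n)%g v = iter n f v.
Proof. by elim: n => [|n ih]; rewrite ?expg0 // expgS iterS -ih. Qed.

Lemma endomorphism_exp_selfmap (D : nzRingType) (V : lmodType D)
    (f : endomorphism V) n :
  ((f ^+ n)%g : selfmap V) = ((f : selfmap V) ^+ n)%g.
Proof. by elim: n => [|n ih]; rewrite ?expg0 // !expgS -ih. Qed.

Lemma strong_inner_inverse_selfmap (D : nzRingType) (V : lmodType D)
    (x y : endomorphism V) :
  strong_inner_inverse x y ->
  strong_inner_inverse (x : selfmap V) (y : selfmap V).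
Proof.
move=> hxy i j k ij kj; rewrite -!endomorphism_exp_selfmap.
have /(congr1 (fun f : endomorphism V => (f : selfmap V))) := hxy i j k ij kj.
exact.
Qed.

(** The defining identity at [(n, n.+1, n.+1)]: if [u] is an [x ^+ n.+1]-image
    for every [n], then [y u] is an [x ^+ n]-image for every [n]. *)
Lemma strong_inner_inverse_height (V : Type) (x y : selfmap V) n (z : V) :
  strong_inner_inverse x y ->
  y (iter n.+1 x z) = iter n x (iter n.+1 y (iter n.+1 x z)).
Proof.
move=> /(_ n n.+1 n.+1 (leqnSn n) (leqnn _)).
rewrite subSnn subnn expg1 expg0 mulg1 => /(congr1 (fun f => f z)) /esym.
rewrite -!selfmap_expE; exact.
Qed.

Theorem proposition9 (D : unitRingType) (hD : is_division_ring D)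
    (V : lmodType D) (b : nat -> nat -> V) (bplus : V)
    (hb : is_basis (basis_family b bplus))
    (x : endomorphism V)
    (hx : forall n i : nat, (0 < i < n)%N -> x (b n i) = b n i.+1)
    (hxn : forall n : nat, (0 < n)%N -> x (b n n) = bplus)
    (hxplus : x bplus = 0) :
  (~ exists y : endomorphism V, strong_inner_inverse x y) /\
  (~ exists y : selfmap V, strong_inner_inverse (x : selfmap V) y).
Proof.
suff noinv : ~ exists y : selfmap V, strong_inner_inverse (x : selfmap V) y.
  split=> // -[y hy]; apply: noinv; exists (y : selfmap V).
  exact: strong_inner_inverse_selfmap.
move=> [y hy].
apply: (infinite_height_not_preimage hb hx hxn hxplus (w := y bplus)) => // [n|].
  exists (iter n.+1 y bplus).
  rewrite -(iter_shift_top hx hxn n).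
  exact: strong_inner_inverse_height hy.
have := hy 1%N 1%N 1%N isT isT.
rewrite subnn !expg1 !expg0 mul1g mulg1 => /(congr1 (fun f => f (b 1%N 1%N))).
by rewrite -(hxn 1%N isT); apply.
Qed.
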